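(* Let $\kappa$ be an infinite cardinal and let $G=\bigcup_{\alpha<\kappa}G_\alpha$ be a group of cardinality $\kappa$ which is the limit of regular representations of length $\kappa$ with base $G_0=Sym(n)$ for some $n\ge 7$, with $|G_\alpha|<\kappa$ for all $\alpha<\kappa$. Let $A\subseteq\kappa$ be a club subset, enumerated increasingly by $(a_\alpha:\alpha<\kappa)$, such that $a_\alpha$ is not a limit ordinal whenever $\alpha$ is not a limit ordinal. Let $\mathcal{G}_A$ be the group and, for $\mathbf{g}\in\mathcal{G}_A$, let $\Phi^{\mathbf{g}}$ be the $A$-level preserving automorphism of $G$, both defined in the context. Then the map $\Theta:\mathcal{G}_A\to Aut_A(G)$, $\Theta(\mathbf{g})=\Phi^{\mathbf{g}}$, is an isomorphism from $\mathcal{G}_A$ onto $Aut_A(G)$.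
   Context: Limit of regular representations of length $\kappa$ with base $G_0$: $G_{\alpha+1}=Sym(G_\alpha)$ with $G_\alpha\hookrightarrow G_{\alpha+1}$ via its right regular representation for all $\alpha<\kappa$ (products in symmetric groups are compositions of functions, and $x\in G_\alpha$ corresponds to the permutation $y\mapsto yx^{-1}$), and $G_\gamma=\varinjlim_{\alpha<\gamma}G_\alpha$ for limit $\gamma<\kappa$; $G$ is the direct limit of all $G_\alpha$. Each $G_\alpha$ is identified with its image, so $G_\alpha\leqslant G_\beta\leqslant G$ for $\alpha<\beta<\kappa$ and $G_\gamma=\bigcup_{\alpha<\gamma}G_\alpha$ for limit $\gamma$. A club subset of $\kappa$ is a closed and unbounded subset; $A$ is assumed to have an increasing enumeration $(a_\alpha:\alpha<\kappa)$ of length $\kappa$ (so $a_\gamma=\sup_{\alpha<\gamma}a_\alpha$ for limit $\gamma$). The ordinal $0$ is non-limit. $Aut(G)$ is a group under composition, and $Aut_A(G)$ is the subgroup of all $\varphi\in Aut(G)$ with $\varphi[G_\alpha]=G_\alpha$ for all $\alpha\in A$ (the $A$-level preserving automorphisms). $\mathbf{C}_L(H)$ is the centralizer of $H$ in $L$; set $G_{a_{-1}}=\{1_G\}$, so $\mathbf{C}_{G_{a_0}}(G_{a_{-1}})=G_{a_0}$. Write $\iota_g(x)=gxg^{-1}$. As a set, $\mathcal{G}_A=\prod_{\alpha<\kappa,\ \alpha\text{ non-limit}}\mathbf{C}_{G_{a_\alpha}}(G_{a_{\alpha-1}})$. For $\mathbf{g}=(g_\alpha:\alpha<\kappa,\ \alpha\text{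 non-limit})\in\mathcal{G}_A$ define automorphisms $\Phi^{\mathbf{g}}_\alpha$ of $G$ ($\alpha<\kappa$) recursively: $\Phi^{\mathbf{g}}_0=\iota_{g_0}$; $\Phi^{\mathbf{g}}_{\alpha+1}=\iota_{g_{\alpha+1}}\circ\Phi^{\mathbf{g}}_\alpha$; for limit $\gamma<\kappa$, let $\Psi^{\mathbf{g}}_\gamma=\bigcup_{\alpha<\gamma}(\Phi^{\mathbf{g}}_\alpha\upharpoonright G_{a_\alpha})$, an automorphism of $G_{a_\gamma}$, let $\psi^{\mathbf{g}}_\gamma\in G_{a_\gamma+1}=Sym(G_{a_\gamma})$ be this permutation regarded as an element of $G$, and set $\Phi^{\mathbf{g}}_\gamma=\iota_{\psi^{\mathbf{g}}_\gamma}$. These satisfy $\Phi^{\mathbf{g}}_\alpha[G_{a_\delta}]=G_{a_\delta}$ and $\Phi^{\mathbf{g}}_\beta\upharpoonright G_{a_\beta}=\Phi^{\mathbf{g}}_\alpha\upharpoonright G_{a_\beta}$ for all $\beta<\alpha\le\delta<\kappa$. Put $\Phi^{\mathbf{g}}=\bigcup_{\alpha<\kappa}(\Phi^{\mathbf{g}}_\alpha\upharpoonright G_{a_\alpha})$, an element of $Aut_A(G)$. The multiplication on $\mathcal{G}_A$ is $\mathbf{g}\cdot\mathbf{h}=(g_\alpha\,\Phi^{\mathbf{g}}_{\alpha-1}(h_\alpha):\alpha<\kappa,\ \alpha\text{ non-limit})$, where $\Phi^{\mathbf{g}}_{-1}(h_0)=h_0$; this makes $\mathcal{G}_A$ a group.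 *)

(* Defs.v *)
(* The infinite cardinal [kappa], seen as an ordinal, is a type [K] with a
   total order [<] which is well founded and initial; the elements of [K] are
   the ordinals [alpha < kappa].  An arbitrary group is a [groupType]; a group
   whose carrier is a subset [X] of a type (a subgroup, a symmetric group, an
   automorphism group, ...) is given by [X] and the binary operation. *)
From mathcomp Require Import all_boot all_order.
From mathcomp Require Import boolp classical_sets functions cardinality.

Set Implicit Arguments.
Unset Strict Implicit.
Unset Printing Implicit Defensive.

Local Open Scope classical_set_scope.
Local Open Scope card_scope.
Local Open Scope group_scope.

Section Ordinals.
Context {d : Order.disp_t} {K : orderType d}.
Implicit Types (a b c : K) (A : set K).

Definition below a : set K := [set b | (b < a)%O].

Definition card_lt T U (X : set T) (Y : set U) : Prop := X #<= Y /\ X #!= Y.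

Definition wf_order : Prop := well_founded (fun a b => (a < b)%O : Prop).

Record infinite_cardinal : Prop := InfiniteCardinal {
  cardinal_wf : wf_order;
  cardinal_infinite : infinite_set [set: K];
  cardinal_initial : forall a, card_lt (below a) [set: K] }.

(* [is_succ a b] : b = a + 1 *)
Definition is_succ a b : Prop :=
  (a < b)%O /\ forall c, (a < c)%O -> (b <= c)%O.

(* 0 is not a limit *)
Definition is_limit a : Prop :=
  (exists b, (b < a)%O) /\ ~ exists b, is_succ b a.

Definition nonlimit : Type := {a : K | ~ is_limit a}.

(* [Some (a - 1)] if [a] is a successor, [None] otherwise *)
Definition opred a : option K :=
  xget None [set o | exists2 b, is_succ b a & o = Some b].

Definition unbounded A : Prop := forall a, exists2 b, A b & (a < b)%O.

Definition closed_in A : Prop := forall l, is_limit l ->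
  (forall a, (a < l)%O -> exists b, [/\ A b, (a < b)%O & (b < l)%O]) -> A l.

Definition club A : Prop := closed_in A /\ unbounded A.

(* Transfinite recursion: [step f a] should depend only on the values of [f]
   below [a]; all other values are replaced by [x0]. *)
Definition trec (wf : wf_order) T (x0 : T) (step : (K -> T) -> K -> T) : K -> T :=
  Fix wf (fun _ => T) (fun a rec =>
    step (fun b => if pselect ((b < a)%O : Prop) is left h then rec b h else x0) a).

Lemma trecE (wf : wf_order) T (x0 : T) (step : (K -> T) -> K -> T) a :
  trec wf x0 step a =
  step (fun b => if (b < a)%O then trec wf x0 step b else x0) a.
Proof.
rewrite /trec Fix_eq => [|b f g fg].
  congr step; apply/funext => b.
  by case: pselect => [h|/negP/negbTE ->] //; rewrite h.
by congr step; apply/funext => c; case: pselect => // h; rewrite fg.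
Qed.

End Ordinals.
Arguments infinite_cardinal {d} K.
Arguments wf_order {d} K.
Arguments nonlimit {d} K.

Section GroupsOnSets.

Record is_group T (X : set T) (mul : T -> T -> T) : Prop := IsGroup {
  is_group_mul : forall x y, X x -> X y -> X (mul x y);
  is_group_assoc : forall x y z, X x -> X y -> X z ->
    mul x (mul y z) = mul (mul x y) z;
  is_group_id_inv : exists2 e, X e & forall x, X x ->
    [/\ mul e x = x, mul x e = x
      & exists y, [/\ X y, mul y x = e & mul x y = e]] }.

Record group_iso T U (X : set T) (mulX : T -> T -> T)
    (Y : set U) (mulY : U -> U -> U) (f : T -> U) : Prop := GroupIso {
  group_iso_dom : is_group X mulX;
  group_iso_cod : is_group Y mulY;
  group_iso_bij : set_bij X Y f;
  group_iso_morph : forall x y, X x -> X y -> f (mulX x y) = mulY (f x) (f y) }.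

Definition Sym T : set (T -> T) := [set f | bijective f].

Variable G : groupType.

Definition subgroup (H : set G) : Prop := group_closed (mem H).

Definition centralizer (L H : set G) : set G :=
  [set x | L x /\ forall y, H y -> commute x y].

Definition iota_inner (g x : G) : G := g * x * g^-1.

Definition Aut : set (G -> G) :=
  [set f | bijective f /\ forall x y, f (x * y) = f x * f y].

(* The union of the restrictions F i |` D i, i in P; outside of
   \bigcup_(i in P) D i (and if the restrictions are not compatible) the value
   is unspecified. *)
Definition union_fun I (P : set I) (D : I -> set G) (F : I -> G -> G) : G -> G :=
  fun x => xget 1 [set y | exists i, [/\ P i, D i x & y = F i x]].

End GroupsOnSets.
Arguments Aut : clear implicits.

Section Limit.
Context {d : Order.disp_t} {K : orderType d} {G : groupType}.

Definition is_Sym (n : nat) (H : set G) : Prop :=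
  exists e : G -> 'I_n -> 'I_n,
    group_iso H *%g (@Sym 'I_n) (@comp _ _ _) e.

(* [lev alpha] is G_alpha, as a subgroup of the limit G, and [rep alpha] is the
   identification of G_(alpha+1) with Sym(G_alpha); only the values of
   [rep alpha] on G_(alpha+1) are meaningful.  As each G_alpha is identified
   with its image in G, the embedding of G_alpha in G_(alpha+1) is inclusion,
   and [rep_regular] says that it is the right regular representation. *)
Record regular_limit (n : nat) (lev : K -> set G)
    (rep : forall alpha, G -> lev alpha -> lev alpha) : Prop := RegularLimit {
  lev_subgroup : forall alpha, subgroup (lev alpha);
  lev_mono : forall alpha beta, (alpha <= beta)%O -> lev alpha `<=` lev beta;
  lev_base : forall zero, (forall alpha, (zero <= alpha)%O) -> is_Sym n (lev zero);
  rep_iso : forall alpha beta, is_succ alpha beta ->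
    group_iso (lev beta) *%g (@Sym (lev alpha)) (@comp _ _ _) (rep alpha);
  rep_regular : forall alpha x (y : lev alpha), lev alpha x ->
    val (rep alpha x y) = val y * x^-1;
  lev_limit : forall gamma, is_limit gamma ->
    lev gamma = \bigcup_(alpha in below gamma) lev alpha;
  lev_cover : \bigcup_alpha lev alpha = [set: G] }.

Variables (wf : wf_order K) (lev : K -> set G).
Variable rep : forall alpha, G -> lev alpha -> lev alpha.
Variables (A : set K) (a : K -> K).

Definition Aut_level : set (G -> G) :=
  [set f | Aut G f /\ forall alpha, A alpha -> f @` lev alpha = lev alpha].

(* G_(a_(alpha-1)), where G_(a_(-1)) = 1 *)
Definition lev_pred (alpha : K) : set G :=
  if opred alpha is Some beta then lev (a beta) else [set 1].

Definition GA : set (nonlimit K -> G) :=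
  [set g | forall alpha : nonlimit K,
     centralizer (lev (a (sval alpha))) (lev_pred (sval alpha)) (g alpha)].

(* The element of G_(alpha+1) identified by [rep alpha] with the permutation f
   of G_alpha *)
Definition perm_elt (alpha : K) (f : G -> G) : G :=
  xget 1 [set p | (exists2 beta, is_succ alpha beta & lev beta p) /\
                  forall y : lev alpha, val (rep p y) = f (val y)].

Section Phi.
Variable g : nonlimit K -> G.

Definition Psi_of (Phi : K -> G -> G) (gamma : K) : G -> G :=
  union_fun (below gamma) (fun alpha => lev (a alpha)) Phi.

Definition Phi_step (Phi : K -> G -> G) (alpha : K) : G -> G :=
  match pselect (is_limit alpha) with
  | left _ => iota_inner (perm_elt (a alpha) (Psi_of Phi alpha))
  | right nlim =>
      iota_inner (g (exist _ alpha nlim)) \o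
      (if opred alpha is Some beta then Phi beta else id)
  end.

(* The empty composition [id] of [Phi_step] is Phi_(-1): Phi_0 = iota_(g_0). *)
Definition Phi : K -> G -> G := trec wf id Phi_step.

Lemma PhiE (alpha : K) : Phi alpha = Phi_step Phi alpha.
Proof.
rewrite {1}/Phi trecE -/Phi /Phi_step; case: pselect => [lim|nlim].
  congr (iota_inner (perm_elt _ _)); apply/funext => x; rewrite /Psi_of /union_fun.
  by congr xget; apply/seteqP; split=> y [b [/= lt_b xb ->]];
    exists b; rewrite /= lt_b.
by rewrite /opred; case: xgetP => [o -> [b [lt_b _] ->]|//]; rewrite lt_b.
Qed.

Definition Theta : G -> G :=
  union_fun [set: K] (fun alpha => lev (a alpha)) Phi.

End Phi.

Definition GA_mul (g h : nonlimit K -> G) : nonlimit K -> G := fun alpha =>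
  g alpha * (if opred (sval alpha) is Some beta then Phi g beta (h alpha)
             else h alpha).

End Limit.
Arguments regular_limit {d K G} n lev rep.
Arguments GA_mul {d K G} wf lev rep a g h.
Arguments Theta {d K G} wf lev rep a g.

(* Main.v *)
(* For a_alpha non-limit, G_(a_alpha) is a symmetric group on at least 7 points,
   hence complete by the Hoelder-Schreier-Ulam theorem: its automorphisms are
   inner and its center is trivial.  At limit stages Phi_gamma extends any
   automorphism of G_(a_gamma), because conjugating the right translation by x
   with an automorphism f gives the right translation by f x.  So an A-level
   preserving automorphism f agrees on every G_(a_alpha) with conjugation by some
   c_alpha, which for non-limit alpha lies in G_(a_alpha) and is unique there; the
   preimage of f under Theta is g_alpha = c_alpha c_(alpha-1)^-1,
   where c_(-1) = 1. *)
Require Import Defs.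
From mathcomp Require Import all_boot all_order.
From mathcomp Require Import boolp classical_sets functions cardinality.

Local Open Scope classical_set_scope.
Local Open Scope card_scope.

(** * Transpositions and their recognition inside a symmetric group *)

Section SymmetricGroups.
Set Implicit Arguments.
Unset Strict Implicit.
Unset Printing Implicit Defensive.
Context {T : eqType}.
Implicit Types (x y z p q r : T) (f t u : T -> T).

Definition swap x y : T -> T :=
  fun z => if z == x then y else if z == y then x else z.

Lemma swapC x y : swap x y = swap y x.
Proof.
by apply/funext=> z; rewrite /swap; case: eqP => [->|//]; case: eqP.
Qed.

Lemma swapL x y : swap x y x = y.
Proof. by rewrite /swap eqxx. Qed.

Lemma swapR x y : swap x y y = x.
Proof. by rewrite swapC swapL. Qed.

Lemma swapN x y z : z != x -> z != y -> swap x y z = z.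
Proof. by rewrite /swap => /negbTE-> /negbTE->. Qed.

Lemma swap_moves x y z : swap x y z <> z -> z = x \/ z = y.
Proof. by rewrite /swap; do 2![case: eqP => [->|_]; first by auto]. Qed.

Lemma swapK x y : involutive (swap x y).
Proof.
move=> z; rewrite /swap; case: (eqVneq z x) => [->|zx].
  by case: (eqVneq y x) => [->|]; rewrite ?eqxx.
by case: (eqVneq z y) => [->|/negbTE ->]; rewrite ?eqxx ?(negbTE zx).
Qed.

Lemma swap_inj x y : injective (swap x y).
Proof. exact: can_inj (swapK x y). Qed.

Lemma swap_bij x y : Sym (swap x y).
Proof. exact: inv_bij (swapK x y). Qed.

Lemma swap_conj f x y : injective f -> f \o swap x y = swap (f x) (f y) \o f.
Proof.
by move=> /inj_eq fE; apply/funext=> z; rewrite /swap/= !fE; do 2?case: ifP.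
Qed.

Lemma swap_eqL x y p q : swap x y = swap p q -> x != y -> x = p \/ x = q.
Proof.
move=> e xy; apply: swap_moves; rewrite -e swapL => yx; by rewrite yx eqxx in xy.
Qed.

Definition transp t := exists x y, x != y /\ t = swap x y.

Lemma transp_moves t p : transp t -> t p <> p -> t = swap p (t p).
Proof.
move=> [x [y [xy ->]]] /swap_moves[->|->]; first by rewrite swapL.
by rewrite swapR swapC.
Qed.

(** Disjoint transpositions commute, so the supports share a point; the cases run over which points
    coincide. If the other points coincided too, the two transpositions would be equal and
    commute. *)
Lemma transp_noncomm t u : transp t -> transp u -> t \o u <> u \o t ->
  exists p q r, [/\ uniq [:: p; q; r], t = swap p q & u = swap p r].
Proof.
move=> [x [y [xy ->]]] [z [w [zw ->]]] nc.
have share p q r : p != q -> p != r ->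
    swap p q \o swap p r <> swap p r \o swap p q -> uniq [:: p; q; r].
  by move=> pq pr h; rewrite /= !inE negb_or pq pr/= andbT; apply/eqP => qr; apply: h; rewrite qr.
have [xz|xz] := eqVneq x z.
  by subst z; exists x, y, w; split=> //; exact: share.
have [xw|xw] := eqVneq x w.
  subst w; exists x, y, z; split=> //; last exact: swapC.
  by apply: share => //; rewrite swapC in nc *; rewrite (swapC x z).
have [yz|yz] := eqVneq y z.
  subst z; exists y, x, w; split=> //; last exact: swapC.
  by apply: share => //; [rewrite eq_sym|rewrite (swapC y x)].
have [yw|yw] := eqVneq y w.
  subst w; exists y, x, z; split=> //; try exact: swapC.
  by apply: share; [rewrite eq_sym|rewrite eq_sym eq_sym|rewrite (swapC y x) (swapC y z)].
case: nc; rewrite [RHS]swap_conj; last exact: can_inj (swapK z w).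
by rewrite !swapN.
Qed.

(* A group-theoretic characterization of the transpositions on at least 7 points;
   on 6 points it also holds of the products of three disjoint transpositions,
   whence the outer automorphism of S_6. *)
Definition three_transp t :=
  [/\ t \o t = id, t <> id & forall f u, Sym f -> Sym u -> u \o f = f \o t ->
    let v := t \o u in v \o v = id \/ v \o v \o v = id].

(** The permutation [u] is the conjugate of [t] by [f], hence again a transposition. If the two
    commute, the product squares to the identity; otherwise they share exactly one point and the
    product is a 3-cycle. *)
Lemma transp_three_transp t : transp t -> three_transp t.
Proof.
move=> tT; have [x [y [xy tE]]] := tT; split.
- by rewrite tE; apply/funext => z; exact: swapK.
- by rewrite tE => /(congr1 (@^~ x)); rewrite swapL => yx; rewrite yx eqxx in xy.
move=> f u fS uS e v.
have uE : u = swap (f x) (f y).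
  have [g fK gK] := fS.
  apply/funext => z; rewrite -[z]gK; have /(congr1 (@^~ (g z)))/= -> := e.
  by rewrite tE -[RHS]/((swap (f x) (f y) \o f) (g z)) -swap_conj //; exact: bij_inj.
have uT : transp u by exists (f x), (f y); split=> //; rewrite inj_eq //; exact: bij_inj.
have tt : t \o t = id by rewrite tE; apply/funext => z; exact: swapK.
have uu : u \o u = id by rewrite uE; apply/funext => z; exact: swapK.
have [c|nc] := pselect (t \o u = u \o t).
  by left; rewrite /v {1}c -[LHS]compA [t \o _]compA tt.
right; have {nc}[p [q [r [pqr tpq upr]]]] := transp_noncomm tT uT nc.
have tI : injective t by rewrite tE; exact: swap_inj.
have uI : injective u by apply: bij_inj.
have /andP[/andP[pq pr] qr] : (p != q) && (p != r) && (q != r).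
  by move: pqr; rewrite /= !inE negb_or andbT.
have conj1 : t \o u \o t = swap q r.
  rewrite upr swap_conj // -[LHS]compA tt -[LHS]/(swap _ _) {1 2}tpq swapL.
  by rewrite swapN // eq_sym.
have conj2 : u \o t \o u = swap r q.
  rewrite tpq swap_conj // -[LHS]compA uu -[LHS]/(swap _ _) {1 2}upr swapL.
  by rewrite swapN // eq_sym.
(* By the braid relation [tut = utu], the cube of [tu] is the square of one transposition. *)
have -> : v \o v \o v = (t \o u \o t) \o (u \o t \o u) by [].
by rewrite conj1 conj2 (swapC r q); apply/funext => z; exact: swapK.
Qed.

(** The default [head x0 s] makes the last entry wrap round to the first, so [next s] is the cycle
    along [s]. *)
Lemma next_nth_uniq x0 (s : seq T) i : uniq s -> i < size s ->
  next s (nth x0 s i) = nth (head x0 s) s i.+1.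
Proof.
by case: s => // y s us lti; rewrite next_nth mem_nth // index_uniq.
Qed.

Lemma next_bij (s : seq T) : uniq s -> Sym (next s).
Proof. by move=> us; exists (prev s); [exact: prev_next|exact: next_prev]. Qed.

Hypothesis seven : forall s : seq T, size s <= 6 -> exists x, x \notin s.

(** If the involution [t] moves a second pair of points, conjugating it by a suitable cycle gives a
    [u] for which an orbit of [tu] has length neither 1, 2 nor 3. *)
Lemma three_transp_transp t : three_transp t -> transp t.
Proof.
move=> [tt tN1 t3]; have tK z : t (t z) = z by exact: (congr1 (@^~ z) tt).
have tS : Sym t by exists t.
have [q tq] : exists q, t q <> q.
  by apply: contrapT => /forallNP h; apply: tN1; apply/funext => z; exact: contrapT (h z).
(* Either [t] moves a point outside its orbit of [q], or [t] is the transposition of [q] and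
   [t q]. *)
have [[p ps tp]|tN] := pselect (exists2 p, p \notin [:: q; t q] & t p <> p); last first.
  exists q, (t q); split; first by apply/eqP => e; exact: tq.
  apply/funext => z; have [->|zq] := eqVneq z q; first by rewrite swapL.
  have [->|ztq] := eqVneq z (t q); first by rewrite swapR tK.
  rewrite swapN //; apply: contrapT => tz; apply: tN.
  by exists z; rewrite // !inE negb_or zq.
(* The defining condition, applied to the cycle along [s] and the conjugate of [t] by it. *)
have conj_next s : uniq s -> let c := next s in
    exists2 u, forall z, u (c z) = c (t z) &
      let v := t \o u in v \o v = id \/ v \o v \o v = id.
  move=> us c; have cS : Sym c := next_bij us.
  have pS : Sym (prev s) by exists c; [exact: next_prev|exact: prev_next].
  exists (c \o t \o prev s) => [z|]; first by rewrite /= prev_next.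
  apply: (t3 c) => //; last by apply/funext => z /=; rewrite prev_next.
  exact: bij_comp (bij_comp cS tS) pS.
pose tclosed (s : seq T) := forall z, z \in s -> t z \in s.
have add_pair z (s : seq T) : t z <> z -> z \notin s -> uniq s -> tclosed s ->
    uniq [:: z, t z & s] /\ tclosed [:: z, t z & s].
  move=> tz zs us ts; split=> /=.
    rewrite us inE negb_or zs eq_sym !andbT; apply/andP; split; first exact/eqP.
    by apply: contra zs => /ts; rewrite tK.
  by move=> w; rewrite !inE => /or3P[/eqP->|/eqP->|/ts ->]; rewrite ?tK ?eqxx ?orbT.
have [uq cq] : uniq [:: q; t q] /\ tclosed [:: q; t q] by exact: add_pair.
have [up cp] := add_pair p _ tp ps uq cq.
have [[z tz]|tN] := pselect (exists z, t z = z).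
(* t and its conjugate under a 5-cycle have a product acting as a 5-cycle *)
- have us : uniq [:: z; p; t p; q; t q].
    rewrite cons_uniq up andbT !inE; apply/negP => h.
    by case/or4P: h => /eqP e; move: tz; rewrite e ?tK => /esym // /esym.
  have [u uc v23] := conj_next _ us; exfalso.
  have c0 : next _ z = p := next_nth_uniq z (i := 0) us isT.
  have c1 : next _ p = t p := next_nth_uniq z (i := 1) us isT.
  have c2 : next _ (t p) = q := next_nth_uniq z (i := 2) us isT.
  have c3 : next _ q = t q := next_nth_uniq z (i := 3) us isT.
  have c4 : next _ (t q) = z := next_nth_uniq z (i := 4) us isT.
  have up1 : u p = p by rewrite -{1}c0 uc tz c0.
  have utp : u (t p) = q by rewrite -{1}c1 uc c2.
  have utq : u (t q) = z by rewrite -{1}c3 uc c4.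
  move: us => /=; rewrite !inE !negb_or; case: v23 => /(congr1 (@^~ p)) /=.
    by rewrite up1 utp => <-; rewrite eqxx !andbF.
  by rewrite up1 utp utq tz => ->; rewrite eqxx.
(* t has no fixed point: the same with an 8-cycle, giving two 4-cycles *)
- have {}tN z : t z <> z by move=> e; apply: tN; exists z.
  have [b bs] := @seven [:: p; t p; q; t q] isT.
  have [ub cb] := add_pair b _ (tN b) bs up cp.
  (* The fourth two-point orbit of [t] exists because six points never exhaust [T]; on exactly six
     points the argument would stop here. *)
  have [a as_] := @seven [:: b; t b; p; t p; q; t q] isT.
  have [us _] := add_pair a _ (tN a) as_ ub cb.
  have [u uc v23] := conj_next _ us; exfalso.
  have c1 : next _ (t a) = b := next_nth_uniq a (i := 1) us isT.
  have c2 : next _ b = t b := next_nth_uniq a (i := 2) us isT.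
  have c3 : next _ (t b) = p := next_nth_uniq a (i := 3) us isT.
  have c4 : next _ p = t p := next_nth_uniq a (i := 4) us isT.
  have c5 : next _ (t p) = q := next_nth_uniq a (i := 5) us isT.
  have c6 : next _ q = t q := next_nth_uniq a (i := 6) us isT.
  have c7 : next _ (t q) = a := next_nth_uniq a (i := 7) us isT.
  have ua : u a = t q by rewrite -{1}c7 uc tK c6.
  have uq' : u q = t p by rewrite -{1}c5 uc tK c4.
  have up' : u p = t b by rewrite -{1}c3 uc tK c2.
  move: us => /=; rewrite !inE !negb_or; case: v23 => /(congr1 (@^~ a)) /=.
    by rewrite ua tK uq' tK => ->; rewrite eqxx ?andbF.
  by rewrite ua tK uq' tK up' tK => ->; rewrite eqxx ?andbF.
Qed.

(** * Automorphisms of a symmetric group are inner (Hoelder-Schreier-Ulam) *)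

Section Automorphism.
Variable F : (T -> T) -> (T -> T).
Hypothesis F_bij : set_bij (@Sym T) (@Sym T) F.
Hypothesis F_comp : forall f g, Sym f -> Sym g -> F (f \o g) = F f \o F g.

Let F_Sym f : Sym f -> Sym (F f).
Proof. by have [h _ _] := F_bij; exact: h. Qed.

Let F_inj f g : Sym f -> Sym g -> F f = F g -> f = g.
Proof. by have [_ h _] := F_bij => fS gS; apply: h; exact/mem_set. Qed.

Let F_surj g : Sym g -> exists2 f, Sym f & F f = g.
Proof. by have [_ _ h] := F_bij => /h[f]; exists f. Qed.

Let F_id : F id = id.
Proof.
have idS : Sym (@id T) by exists id.
have [g _ gK] := F_Sym idS; apply/funext => x.
by rewrite -[x in LHS]gK -[LHS]/((F id \o F id) (g x)) -F_comp // gK.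
Qed.

(** The characterization speaks only of composition and the identity, so automorphisms preserve it
    in both directions. *)
Lemma three_transp_aut t : Sym t -> three_transp (F t) <-> three_transp t.
Proof.
move=> tS; have idS : Sym (@id T) by exists id.
have compS f g : Sym f -> Sym g -> Sym (f \o g) by exact: bij_comp.
split=> -[tt t1 t3]; split.
- by apply: F_inj => //; [exact: compS|rewrite F_comp // tt F_id].
- by move=> tE; apply: t1; rewrite tE F_id.
- move=> f u fS uS e v; have vS : Sym v by exact: compS.
  have [||/=|e'|e'] := t3 (F f) (F u); try exact: F_Sym.
  + by rewrite -(F_comp uS fS) -(F_comp fS tS) e.
  + left; apply: F_inj => //; first exact: compS.
    by rewrite F_id F_comp // F_comp.
  + right; apply: F_inj => //; first by apply: (compS) => //; exact: compS.
    by rewrite F_id F_comp //; [rewrite F_comp // F_comp|exact: compS].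
- by rewrite -F_comp // tt F_id.
- by move=> tE; apply: t1; apply: F_inj => //; rewrite F_id.
- move=> f u /F_surj[{}f fS <-] /F_surj[{}u uS <-] e v.
  have vS : Sym (t \o u) by exact: compS.
  have [||/=|e'|e'] := t3 f u => //.
  + by apply: F_inj; [exact: compS|exact: compS|rewrite (F_comp uS fS) (F_comp fS tS)].
  + by left; rewrite /v -(F_comp tS uS) -(F_comp vS vS) e' F_id.
  + right; rewrite /v -(F_comp tS uS) -(F_comp vS vS) -(F_comp (compS _ _ vS vS) vS).
    by rewrite e' F_id.
Qed.

Let F_transp t : Sym t -> transp (F t) <-> transp t.
Proof.
by move=> tS; split=> /transp_three_transp /(three_transp_aut tS);
  exact: three_transp_transp.
Qed.

(** Since [F] permutes the transpositions and respects which of them commute, it acts on them as a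
    permutation [s] of the points; [F f] is then determined by how it conjugates transpositions. *)
Lemma Sym_aut_inner :
  exists2 s, Sym s & forall f, Sym f -> F f \o s = s \o f.
Proof.
have other (s : seq T) : size s <= 2 -> exists x, x \notin s.
  by move=> s2; apply: seven; exact: leq_trans s2 _.
have swapT x y : x != y -> transp (F (swap x y)).
  by move=> xy; apply/F_transp; [exact: swap_bij|exists x, y].
have FswapI x y z w : F (swap x y) = F (swap z w) -> swap x y = swap z w.
  by apply: F_inj; exact: swap_bij.
have swap3 x y z : uniq [:: x; y; z] -> swap x y \o swap x z \o swap x y = swap y z.
  move=> u; rewrite (@swap_conj (swap x y) x z); last exact: swap_inj.
  have -> : swap x y z = z by move: u; rewrite /= !inE negb_or => /and3P[/andP[? ?] ? _];
    rewrite swapN // eq_sym.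
  by rewrite swapL; apply/funext => w /=; rewrite swapK.
have ncomm x y z : uniq [:: x; y; z] ->
    F (swap x y) \o F (swap x z) <> F (swap x z) \o F (swap x y).
  rewrite /= !inE negb_or => /and3P[/andP[xy xz] yz _].
  rewrite -(F_comp (swap_bij x y) (swap_bij x z)) -(F_comp (swap_bij x z) (swap_bij x y)).
  move=> /F_inj e; have /(congr1 (@^~ x)) /= : swap x y \o swap x z = swap x z \o swap x y.
    by apply: e; apply: bij_comp; exact: swap_bij.
  by rewrite !swapL !swapN // 1?eq_sym // => zy; rewrite zy eqxx in yz.
have FswapS x y : Sym (F (swap x y)) by apply: F_Sym; exact: swap_bij.
have F_swap3 x y z : F (swap x y \o swap x z \o swap x y) =
    F (swap x y) \o F (swap x z) \o F (swap x y).
  have [xyS xzS] := (swap_bij x y, swap_bij x z).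
  by rewrite (F_comp (bij_comp xyS xzS) xyS) (F_comp xyS xzS).
have uniq3 x y z : y != x -> z != x -> z != y -> uniq [:: x; y; z].
  by rewrite /= !inE negb_or andbT !(eq_sym x) (eq_sym y z) => -> -> ->.
(* The transpositions through x are mapped to transpositions through a common
   point p, which will be the image s x. *)
have center x : exists p, forall w, w != x -> F (swap x w) p <> p.
  have [y yx] := other [:: x] isT; have [z zxy] := other [:: x; y] isT.
  move: yx zxy; rewrite !inE negb_or => yx /andP[zx zy].
  have uxyz : uniq [:: x; y; z] by exact: uniq3.
  have [||p [q [r [pqr Fy Fz]]]] := transp_noncomm _ _ (ncomm _ _ _ uxyz).
  - by apply: swapT; rewrite eq_sym.
  - by apply: swapT; rewrite eq_sym.
  move: (pqr); rewrite /= !inE negb_or => /and3P[/andP[pq pr] qr _].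
  (* If [F (swap x w)] fixed [p], it would have to move [q] and [r] so as not to commute with
     [swap p q] and [swap p r]. It would then be [swap q r], the image of [swap y z], against
     injectivity. *)
  exists p => w wx Fp.
  have [wy|wy] := eqVneq w y.
    by move: Fp pq; rewrite wy Fy swapL => ->; rewrite eqxx.
  have [wz|wz] := eqVneq w z.
    by move: Fp pr; rewrite wz Fz swapL => ->; rewrite eqxx.
  have moves v b : uniq [:: x; v; w] -> F (swap x v) = swap p b -> F (swap x w) b <> b.
    move=> u Fv Fb; apply: (ncomm _ _ _ u); rewrite Fv.
    by rewrite [RHS]swap_conj ?Fp ?Fb //; exact: bij_inj (FswapS _ _).
  have Fq : F (swap x w) q <> q.
    by exact: moves y q (uniq3 _ _ _ yx wx wy) Fy.
  have Fr : F (swap x w) r <> r.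
    by exact: moves z r (uniq3 _ _ _ zx wx wz) Fz.
  have Fw : F (swap x w) = swap q (F (swap x w) q).
    by apply: transp_moves => //; apply: swapT; rewrite eq_sym.
  have : F (swap x w) = F (swap y z).
    rewrite -(swap3 x y z) // F_swap3 Fy Fz swap3 // Fw; congr swap.
    move: Fr; rewrite {1}Fw => /swap_moves[rq|//]; by rewrite rq eqxx in qr.
  by move=> /FswapI /swap_eqL[|xy|xz]; rewrite ?(eq_sym x) // -?xy -?xz ?eqxx in yx zx *.
have [s sP] := choice center.
have FswapM x y : x != y -> F (swap x y) (s x) <> s x /\ F (swap x y) (s y) <> s y.
  by move=> xy; split; [apply: sP; rewrite eq_sym|rewrite swapC; exact: sP].
have sI x y : x != y -> s x != s y.
  move=> xy; apply/eqP => sxy.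
  have [z] := other [:: x; y] isT; rewrite !inE negb_or => /andP[zx zy].
  have [xzT yzT] : transp (F (swap z x)) /\ transp (F (swap z y)) by split; exact: swapT.
  have [_ mx] := FswapM _ _ zx; have [_ my] := FswapM _ _ zy.
  have Fx := transp_moves xzT mx; have Fy := transp_moves yzT my.
  move: Fx Fy mx my; rewrite -sxy.
  move: (F (swap z x) (s x)) (F (swap z y) (s x)) => b c Fx Fy bp cp.
  (* With [s x = s y], the images of [swap z x] and [swap z y] are [swap (s x) b] and [swap (s x) c]
     with [b] and [c] distinct. Conjugating the second by the first yields [F (swap x y)], which
     then fixes [s x]: a contradiction. *)
  have [my' _] := FswapM _ _ xy; apply: my'.
  rewrite -(swap3 z x y) ?F_swap3; last by apply: uniq3; rewrite 1?eq_sym // eq_sym.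
  rewrite Fx Fy /= swapL (@swapN (s x) c b) ?swapR //; apply/eqP => //.
  move=> bc; rewrite -bc -Fx in Fy; move: Fy => /FswapI /(congr1 (@^~ z)).
  by rewrite !swapL => yx; rewrite yx eqxx in xy.
have Fswap x y : x != y -> F (swap x y) = swap (s x) (s y).
  move=> xy; have [mx my] := FswapM _ _ xy.
  have e := transp_moves (swapT _ _ xy) mx; rewrite e; congr swap.
  move: my; rewrite {1}e => /swap_moves[syx|//].
  by have := sI _ _ xy; rewrite syx eqxx.
exists s => [|f fS].
  rewrite /Sym /= -setTT_bijective; split=> //.
    by move=> x y _ _ sxy; apply: contrapT => /eqP /sI; rewrite sxy eqxx.
  (* Surjectivity of [s]: a transposition moving [p] is the image of some [swap x y], so [p] is
     [s x] or [s y]. *)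
  move=> p _; have [q] := other [:: p] isT; rewrite inE => qp.
  have [t tS tE] := F_surj (swap_bij p q).
  have /(F_transp tS)[x [y [xy tE']]] : transp (F t).
    by rewrite tE; exists p, q; rewrite eq_sym.
  move: tE; rewrite tE' Fswap // => /esym /swap_eqL[|->|->]; first by rewrite eq_sym.
    by exists x.
  by exists y.
apply/funext => x /=.
(* Conjugation by [F f] takes [swap (s x) (s y)] to [swap (s (f x)) (s (f y))]. This leaves two
   candidates for [F f (s x)], and two different choices of [y] leave only [s (f x)]. *)
have key y : y != x -> F f (s x) = s (f x) \/ F f (s x) = s (f y).
  move=> yx; have fyx : f y != f x by rewrite inj_eq //; exact: bij_inj.
  apply: swap_moves; rewrite -Fswap 1?eq_sym //.
  have FI : injective (F f) by apply: bij_inj; exact: F_Sym.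
  have : F f \o F (swap x y) = F (swap (f x) (f y)) \o F f.
    rewrite -(F_comp fS (swap_bij x y)) -(F_comp (swap_bij _ _) fS) swap_conj //.
    exact: bij_inj.
  rewrite Fswap 1?eq_sym // => /(congr1 (@^~ (s x))) /= <-; rewrite swapL => /FI e.
  by have := sI _ _ yx; rewrite e eqxx.
have [y] := other [:: x] isT; rewrite inE => yx.
have [z] := other [:: x; y] isT; rewrite !inE negb_or => /andP[zx zy].
have [//|Fy] := key y yx; have [//|Fz] := key z zx.
have : s (f z) != s (f y) by apply: sI; rewrite inj_eq //; exact: bij_inj.
by rewrite -Fy -Fz eqxx.
Qed.

End Automorphism.

End SymmetricGroups.

(** * Complete subgroups and inner automorphisms *)

Section CompleteGroups.
Set Implicit Arguments.
Unset Strict Implicit.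
Unset Printing Implicit Defensive.
Local Open Scope group_scope.
Context {G : groupType}.
Implicit Types (H : set G) (c x y : G) (f : G -> G).

Lemma subgroup1 H : subgroup H -> H 1.
Proof. by case=> /set_mem. Qed.

Lemma subgroupV H x : subgroup H -> H x -> H x^-1.
Proof. by move=> /group_closedV HV Hx; apply/set_mem/HV/mem_set. Qed.

Lemma subgroupM H x y : subgroup H -> H x -> H y -> H (x * y).
Proof. by move=> /group_closedM HM Hx Hy; apply/set_mem/HM; exact/mem_set. Qed.

(** An automorphism of the subgroup [H] is represented by a map on all of [G] whose values outside
    [H] are arbitrary. *)
Definition aut_on H f : Prop := set_bij H H f /\
  forall x y, H x -> H y -> f (x * y) = f x * f y.

Definition complete H : Prop :=
  (forall f, aut_on H f -> exists2 c, H c & forall x, H x -> f x = iota_inner c x) /\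
  (forall c, H c -> (forall x, H x -> commute c x) -> c = 1).

(** An automorphism of [H] is transported through [e] to [F] on the permutations of [T], where it is
    conjugation by some [s]; the preimage of [s] is the required element. *)
Lemma Sym_complete (T : eqType) H (e : G -> T -> T) :
  (forall s : seq T, size s <= 6 -> exists z, z \notin s) ->
  subgroup H -> group_iso H *%g (@Sym T) (@comp _ _ _) e -> complete H.
Proof.
move=> seven Hgr [_ _ [eH eI eS] eM].
have {}eI x y : H x -> H y -> e x = e y -> x = y.
  by move=> Hx Hy; apply: eI; exact/mem_set.
have e1 : e 1 = id.
  have H1 := subgroup1 Hgr; have [g _ gK] := eH _ H1.
  apply/funext => z; rewrite -[z in LHS]gK.
  by rewrite -[LHS]/((e 1 \o e 1) (g z)) -eM // mulg1 gK.
split=> [f [[fH fI fS] fM]|c Hc cC].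
  have {}fI x y : H x -> H y -> f x = f y -> x = y.
    by move=> Hx Hy; apply: fI; exact/mem_set.
  pose ei (t : T -> T) : G := xget 1 [set x | H x /\ e x = t].
  have eiP t : Sym t -> H (ei t) /\ e (ei t) = t.
    by move=> /eS[x Hx xt]; apply: (@xgetPex _ 1 [set x | H x /\ e x = t]); exists x.
  have eiK x : H x -> ei (e x) = x.
    by move=> Hx; have [h1 h2] := eiP _ (eH _ Hx); exact: eI.
  pose F t := e (f (ei t)).
  have FB : set_bij (@Sym T) (@Sym T) F.
    split.
    - by move=> t /eiP[Ht _]; apply: eH; exact: fH.
    - move=> t u /set_mem/eiP[Ht te] /set_mem/eiP[Hu ue].
      by move=> /eI => /(_ (fH _ Ht) (fH _ Hu)) /fI => /(_ Ht Hu) tu; rewrite -te tu.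
    - move=> _ /eS[_ /fS[x Hx <-] <-]; exists (e x); first exact: eH.
      by rewrite /F eiK.
  have FC t u : Sym t -> Sym u -> F (t \o u) = F t \o F u.
    move=> /eiP[Ht te] /eiP[Hu ue]; rewrite /F -eM ?fM; try exact: fH.
    by rewrite -fM // -{1}te -{1}ue -eM // eiK //; exact: subgroupM.
  have [s /eiP[Hs se] sP] := Sym_aut_inner seven FB FC.
  exists (ei s) => // x Hx; rewrite /iota_inner; apply: (mulIg (ei s)).
  rewrite mulgVK; apply: eI; try by apply: subgroupM => //; exact: fH.
  rewrite !eM //; last exact: fH.
  by rewrite se -sP /F ?eiK //; exact: eH.
apply: eI => //; first exact: subgroup1.
have cT t : Sym t -> e c \o t = t \o e c.
  by move=> /eS[x Hx <-]; rewrite -!eM // (cC x).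
rewrite e1; apply/funext => x; apply: contrapT => cx.
(* If [e c] moves [x], the transposition of [e c x] with a third point [y] fixes [x] but moves
   [e c x], so it does not commute with [e c]. *)
have [y] := @seven [:: x; e c x] isT; rewrite !inE negb_or => /andP[yx ycx].
have /(congr1 (@^~ x))/= := cT _ (swap_bij (e c x) y).
rewrite swapN 1?eq_sym // ?swapL; last by apply/eqP.
by move=> /esym e'; rewrite e' eqxx in ycx.
Qed.

Lemma iota_innerM c c' : iota_inner (c * c') = iota_inner c \o iota_inner c' :> (G -> G).
Proof. by apply/funext => x; rewrite /iota_inner /= invgM !mulgA. Qed.

Lemma iota_inner1 : iota_inner 1 = id :> (G -> G).
Proof. by apply/funext => x; rewrite /iota_inner invg1 mulg1 mul1g. Qed.

Lemma iota_inner_morph c x y : iota_inner c (x * y) = iota_inner c x * iota_inner c y.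
Proof. by rewrite /iota_inner !mulgA mulgVK. Qed.

Lemma iota_innerK c : cancel (iota_inner c) (iota_inner c^-1).
Proof.
by move=> x; rewrite -[LHS]/((iota_inner c^-1 \o iota_inner c) x) -iota_innerM mulVg iota_inner1.
Qed.

Lemma iota_innerVK c : cancel (iota_inner c^-1) (iota_inner c).
Proof. by move=> x; rewrite -[X in iota_inner X]invgK iota_innerK. Qed.

Lemma iota_inner_Aut c : Aut G (iota_inner c).
Proof.
split; last exact: iota_inner_morph.
by exists (iota_inner c^-1); [exact: iota_innerK|exact: iota_innerVK].
Qed.

Lemma iota_inner_fix c x : commute c x <-> iota_inner c x = x.
Proof.
by rewrite /commute /iota_inner; split=> [->|e]; rewrite ?mulgK // -[in RHS]e mulgVK.
Qed.

Lemma iota_inner_in H c x : subgroup H -> H c -> H x -> H (iota_inner c x).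
Proof.
by move=> Hgr Hc Hx; apply: subgroupM => //; [exact: subgroupM|exact: subgroupV].
Qed.

Lemma iota_inner_image H c : subgroup H -> H c -> iota_inner c @` H = H.
Proof.
move=> Hgr Hc; apply/seteqP; split=> [_ [x Hx <-]|x Hx]; first exact: iota_inner_in.
exists (iota_inner c^-1 x); last by rewrite iota_innerVK.
by apply: iota_inner_in => //; exact: subgroupV.
Qed.

Lemma Aut_morph f x y : Aut G f -> f (x * y) = f x * f y.
Proof. by case=> _ ->. Qed.

Lemma Aut_iota f c x : Aut G f -> f (iota_inner c x) = iota_inner (f c) (f x).
Proof.
move=> fA; rewrite /iota_inner; apply: (mulIg (f c)).
by rewrite -Aut_morph // !mulgVK Aut_morph.
Qed.

Lemma Aut_image_aut_on H f : Aut G f -> f @` H = H -> aut_on H f.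
Proof.
move=> [/bij_inj fI fM] fH; split=> // ; split=> [x Hx|x y _ _|x Hx].
- by rewrite -fH; exists x.
- exact: fI.
- by move: Hx; rewrite -{1}fH.
Qed.

Lemma union_funE I (P : set I) (D : I -> set G) (F : I -> G -> G) i x :
  (forall j k y, P j -> P k -> D j y -> D k y -> F j y = F k y) ->
  P i -> D i x -> union_fun P D F x = F i x.
Proof.
move=> Fcompat Pi Dix; rewrite /union_fun.
case: xgetP => [_ -> [j [Pj Djx ->]]|/(_ (F i x))[]]; first exact: Fcompat.
by exists i.
Qed.

End CompleteGroups.

(** * The levels of the limit group along the club set *)

Section Levels.
Set Implicit Arguments.
Unset Strict Implicit.
Unset Printing Implicit Defensive.
Import Order.TTheory.
Local Open Scope group_scope.
Context {d : Order.disp_t} {K : orderType d} (wf : wf_order K).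
Context (n : nat) (n_ge7 : 7 <= n).
Context {G : groupType} (lev : K -> set G).
Context (rep : forall alpha : K, G -> lev alpha -> lev alpha).
Context (G_limit : regular_limit n lev rep).
Context (A : set K) (A_club : club A) (a : K -> K).
Context (a_incr : forall alpha beta : K, (alpha < beta)%O -> (a alpha < a beta)%O).
Context (a_enum : range a = A).
Context (a_nonlimit : forall alpha : K, ~ is_limit alpha -> ~ is_limit (a alpha)).
Implicit Types (b c al be ga de : K) (x y z p : G) (f h : G -> G).

Lemma wf_least (P : K -> Prop) : (exists b, P b) ->
  exists b, P b /\ forall c, P c -> (b <= c)%O.
Proof.
move=> [b]; elim/(well_founded_ind wf): b => b IH Pb.
have [[c [cb Pc]]|nc] := pselect (exists c, (c < b)%O /\ P c); first exact: (IH c).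
by exists b; split=> // c Pc; rewrite leNgt; apply/negP => cb; apply: nc; exists c.
Qed.

(** Unboundedness of [A] gives an element above [b], and the least such element is the successor. *)
Lemma ex_succ b : exists c, is_succ b c.
Proof.
have [c _ bc] := A_club.2 b.
have [e [be e_min]] : exists e, (b < e)%O /\ forall e', (b < e')%O -> (e <= e')%O.
  by apply: (@wf_least (fun e => (b < e)%O : Prop)); exists c.
by exists e.
Qed.

Lemma is_succ_unique b c c' : is_succ b c -> is_succ b c' -> c = c'.
Proof.
by move=> [bc cm] [bc' cm']; apply/le_anti; rewrite cm // cm'.
Qed.

Lemma is_pred_unique b b' c : is_succ b c -> is_succ b' c -> b = b'.
Proof.
move=> [bc cm] [bc' cm']; case: (ltgtP b b') => // [/cm|/cm'] h.
  by move: (lt_le_trans bc' h); rewrite ltxx.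
by move: (lt_le_trans bc h); rewrite ltxx.
Qed.

Lemma is_succ_le b c e : is_succ b c -> (e < c)%O -> (e <= b)%O.
Proof.
by move=> [_ cm] ec; rewrite leNgt; apply/negP => /cm; rewrite leNgt ec.
Qed.

Lemma opred_succ b c : is_succ b c -> opred c = Some b.
Proof.
move=> bc; rewrite /opred; case: xgetP => [_ -> [b' bc' ->]|/(_ (Some b))[]].
  by congr Some; exact: is_pred_unique bc' bc.
by exists b.
Qed.

Lemma opredP c b : opred c = Some b -> is_succ b c.
Proof. by rewrite /opred; case: xgetP => // o -> [b' bc' ->] [<-]. Qed.

Lemma nonlimit_cases c : ~ is_limit c ->
  (opred c = None /\ forall b, (c <= b)%O) \/ exists2 b, is_succ b c & opred c = Some b.
Proof.
move=> cN; have [[b bc]|Nb] := pselect (exists b, is_succ b c).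
  by right; exists b => //; exact: opred_succ.
left; split.
  by case E: opred => [b|//]; case: Nb; exists b; exact: opredP.
move=> b; rewrite leNgt; apply/negP => bc; apply: cN; split=> //; by exists b.
Qed.

Lemma a_mono : {mono a : al be / (al <= be)%O}.
Proof. by apply: le_mono => al be; exact: a_incr. Qed.

Lemma lev_a_mono al be : (al <= be)%O -> lev (a al) `<=` lev (a be).
Proof. by move=> h; apply: (lev_mono G_limit); rewrite a_mono. Qed.

Lemma lev_succ_a al be c : is_succ (a al) c -> (al < be)%O -> lev c `<=` lev (a be).
Proof. by move=> [_ cm] h; apply: (lev_mono G_limit); apply: cm; exact: a_incr. Qed.

Lemma lev_a_cover x : exists al, lev (a al) x.
Proof.
have : setT x by []; rewrite -(lev_cover G_limit) => -[b _ xb].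
have [c Ac bc] := A_club.2 b; move: Ac bc; rewrite -a_enum => -[al _ <-] bal.
by exists al; apply: (lev_mono G_limit) xb; exact: ltW.
Qed.

(** The enumeration is continuous: the supremum [s] of the earlier values is a limit, lies in [A] by
    closedness, and so equals [a ga]. *)
Lemma lev_a_limit ga : is_limit ga ->
  lev (a ga) = \bigcup_(al in below ga) lev (a al).
Proof.
move=> [[b0 b0ga] Nsucc].
have below_succ al : (al < ga)%O -> exists2 be, (al < be)%O & (be < ga)%O.
  move=> alga; have [be be_succ] := ex_succ al; exists be; first by case: be_succ.
  rewrite lt_neqAle be_succ.2 // andbT; apply/eqP => e.
  by apply: Nsucc; exists al; rewrite -e.
have [s [s_ub s_min]] : exists s, (forall al, (al < ga)%O -> (a al < s)%O) /\
    forall s', (forall al, (al < ga)%O -> (a al < s')%O) -> (s <= s')%O.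
  by apply: (@wf_least (fun s => forall al, (al < ga)%O -> (a al < s)%O)); exists (a ga) => al; exact: a_incr.
have s_cof b : (b < s)%O -> exists2 al, (al < ga)%O & (b < a al)%O.
  move=> bs; apply: contrapT => Nal.
  suff : (s <= b)%O by rewrite leNgt bs.
  apply: s_min => al /below_succ[be albe bega]; apply: lt_le_trans (a_incr albe) _.
  by rewrite leNgt; apply/negP => bbe; apply: Nal; exists be.
have s_lim : is_limit s.
  split; first by exists (a b0); exact: s_ub.
  move=> [b bs]; have [al alga bal] := s_cof b bs.1.
  by move: (s_ub _ alga); rewrite ltNge (bs.2 _ bal).
have s_in_A : A s.
  apply: (A_club.1 _ s_lim) => b /s_cof[al alga bal].
  by exists (a al); split=> //; [rewrite -a_enum; exists al|exact: s_ub].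
(* Write [s] as [a de]. Were [de] below [ga], then [a de] would lie strictly below [s]. *)
have -> : a ga = s.
  move: s_in_A; rewrite -a_enum => -[de _ des].
  apply/le_anti/andP; split; last by apply: s_min => al; exact: a_incr.
  by rewrite -des a_mono leNgt; apply/negP => /s_ub; rewrite des ltxx.
rewrite (lev_limit G_limit s_lim); apply/seteqP; split=> x [b /= bs xb].
  have [al alga bal] := s_cof _ bs; exists al => //.
  by apply: (lev_mono G_limit) xb; exact: ltW.
by exists (a b) => //; exact: s_ub.
Qed.

(** * Completeness of the non-limit levels *)

Lemma uniq7_ex_notin (T : eqType) (l : seq T) : uniq l -> 7 <= size l ->
  forall s : seq T, size s <= 6 -> exists w, w \notin s.
Proof.
move=> ul l7 s s6; apply: contrapT => /forallNP h.
have : {subset l <= s} by move=> w _; have /negP := h w; rewrite negbK.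
by move=> /(uniq_leq_size ul)/(leq_trans l7)/leq_trans/(_ s6).
Qed.

(** The base level lies in every level and contains the [n] distinct elements that correspond to
    [swap i0 i], the identity being the one for [i = i0]. *)
Lemma lev_seven_points b (s : seq (lev b)) : size s <= 6 -> exists w, w \notin s.
Proof.
have [o [_ o_min]] : exists o : K, True /\ forall c, True -> (o <= c)%O.
  by apply: wf_least; exists b.
have [c|e [_ _ [_ _ eS] _]] := lev_base G_limit (zero := o); first exact: o_min.
have i0 : 'I_n by exists 0; exact: leq_trans n_ge7.
have {eS}/choice[h hP] : forall i, exists x, lev o x /\ e x = swap i0 i.
  by move=> i; have [x xo xe] := eS _ (swap_bij i0 i); exists x.
have hb i : lev b (h i) by apply: (lev_mono G_limit) (hP i).1; exact: o_min.
apply: (@uniq7_ex_notin _ [seq exist _ (h i) (mem_set (hb i)) : lev b | i <- enum 'I_n]).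
  rewrite map_inj_uniq ?enum_uniq // => i j /(congr1 val)/= hij.
  by rewrite -(swapL i0 i) -(hP i).2 hij (hP j).2 swapL.
by rewrite size_map size_enum_ord.
Qed.

(** A non-limit level is the base, a symmetric group on [n] points, or the symmetric group on the
    preceding level, which has at least seven elements. *)
Lemma lev_complete c : ~ is_limit c -> complete (lev c).
Proof.
move=> /nonlimit_cases[[_ c0]|[b bc _]].
  have [e eP] := lev_base G_limit c0.
  apply: Sym_complete eP; last exact: lev_subgroup G_limit c.
  by apply: (@uniq7_ex_notin _ (enum 'I_n)); rewrite ?enum_uniq // size_enum_ord.
apply: Sym_complete (rep_iso G_limit bc); last exact: lev_subgroup G_limit c.
exact: lev_seven_points.
Qed.

Lemma lev_a_complete al : ~ is_limit al -> complete (lev (a al)).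
Proof. by move=> /a_nonlimit; exact: lev_complete. Qed.

(** * Permutations of a level as elements of the next level *)

Lemma perm_eltP b c f : is_succ b c -> set_bij (lev b) (lev b) f ->
  lev c (perm_elt rep b f) /\
  forall y : lev b, val (rep (perm_elt rep b f) y) = f (val y).
Proof.
move=> bc [fL fI fS].
have fL' (y : lev b) : f (val y) \in lev b by apply/mem_set/fL/set_mem/valP.
pose f' (y : lev b) : lev b := exist _ (f (val y)) (fL' y).
have f'S : Sym f'.
  rewrite /Sym /= -setTT_bijective; split=> //.
    by move=> y z _ _ /(congr1 val)/= /fI; move=> /(_ (valP y) (valP z)) /val_inj.
  move=> y _; have [x xb xy] := fS _ (set_mem (valP y)).
  by exists (exist _ x (mem_set xb)) => //; exact: val_inj.
have [_ _ [_ _ rS] _] := rep_iso G_limit bc.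
have [p pc pf] := rS _ f'S.
rewrite /perm_elt; case: xgetP => [q _ [[c' bc' qc'] qf]|/(_ p)[]].
  by rewrite (is_succ_unique bc bc').
by split; [exists c|move=> y; rewrite pf].
Qed.

Lemma perm_elt_eq b c f p : is_succ b c -> set_bij (lev b) (lev b) f -> lev c p ->
  (forall y : lev b, val (rep p y) = f (val y)) -> perm_elt rep b f = p.
Proof.
move=> bc fB pc pf; have [qc qf] := perm_eltP bc fB.
have [_ _ [_ rI _] _] := rep_iso G_limit bc.
apply: rI; [exact/mem_set|exact/mem_set|apply/funext => y].
by apply: val_inj; rewrite qf pf.
Qed.

Lemma perm_elt_ext b f h : set_bij (lev b) (lev b) f ->
  (forall x, lev b x -> h x = f x) -> perm_elt rep b h = perm_elt rep b f.
Proof.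
move=> fB hf; have [c bc] := ex_succ b; have [pc pf] := perm_eltP bc fB.
apply: (perm_elt_eq bc) => //; first by apply: eq_set_bijLR fB => x /set_mem/hf.
by move=> y; rewrite pf hf //; exact/set_mem/valP.
Qed.

Lemma perm_eltM b f h : set_bij (lev b) (lev b) f -> set_bij (lev b) (lev b) h ->
  perm_elt rep b (f \o h) = perm_elt rep b f * perm_elt rep b h.
Proof.
move=> fB hB; have [c bc] := ex_succ b.
have [pc pf] := perm_eltP bc fB; have [qc qh] := perm_eltP bc hB.
apply: (perm_elt_eq bc); first exact: set_bij_comp hB fB.
- by apply: subgroupM => //; exact: lev_subgroup G_limit c.
- move=> y; have [_ _ _ ->] := rep_iso G_limit bc => //.
  by rewrite /= pf qh.
Qed.

(** With [p] the element for [f], the products [p x] and [(f x) p] act on the level as [y] to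
    [f (y x^-1)] and [y] to [f y (f x)^-1], which agree because [f] is multiplicative. *)
Lemma iota_perm_elt b f x : aut_on (lev b) f -> lev b x ->
  iota_inner (perm_elt rep b f) x = f x.
Proof.
move=> [fB fM] xb; have [c bc] := ex_succ b; have [pc pf] := perm_eltP bc fB.
have [fL fI _] := fB; have [_ _ [_ rI _] rM] := rep_iso G_limit bc.
have bcL : lev b `<=` lev c by apply: (lev_mono G_limit); exact: ltW bc.1.
have cG := lev_subgroup G_limit c; have bG := lev_subgroup G_limit b.
apply: (mulIg (perm_elt rep b f)); rewrite mulgVK.
have fxb : lev b (f x) by exact: fL.
have [xc fxc] := (bcL _ xb, bcL _ fxb).
apply: rI; try by [apply: mem_set; exact: subgroupM].
rewrite !rM //.
apply/funext => y; apply: val_inj.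
rewrite /= pf (rep_regular G_limit _ xb) (rep_regular G_limit _ fxb) pf.
have yb := set_mem (valP y).
apply: (mulIg (f x)); rewrite mulgVK -fM ?mulgVK //.
by apply: subgroupM => //; exact: subgroupV.
Qed.

End Levels.

(** * Gluing level-preserving automorphisms, and the isomorphism [Theta] *)

Section Theta.
Set Implicit Arguments.
Unset Strict Implicit.
Unset Printing Implicit Defensive.
Import Order.TTheory.
Local Open Scope group_scope.
Context {d : Order.disp_t} {K : orderType d} (wf : wf_order K).
Context (n : nat) (n_ge7 : 7 <= n).
Context {G : groupType} (lev : K -> set G).
Context (rep : forall alpha : K, G -> lev alpha -> lev alpha).
Context (G_limit : regular_limit n lev rep).
Context (A : set K) (A_club : club A) (a : K -> K).
Context (a_incr : forall alpha beta : K, (alpha < beta)%O -> (a alpha < a beta)%O).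
Context (a_enum : range a = A).
Context (a_nonlimit : forall alpha : K, ~ is_limit alpha -> ~ is_limit (a alpha)).

Notation Phi := (Phi wf rep a).
Notation Theta := (Theta wf lev rep a).
Notation L := (fun al => lev (a al)).
Notation Aut_A := (Aut_level lev A).
Implicit Types (b c al be ga de : K) (x y z p : G) (f : G -> G) (g h : nonlimit K -> G).

Let levG b : subgroup (lev b). Proof. exact: lev_subgroup G_limit b. Qed.

Let a_le al be : (al <= be)%O -> lev (a al) `<=` lev (a be).
Proof. exact: (lev_a_mono G_limit a_incr). Qed.

Lemma Aut_levelP f : Aut_A f <-> Aut G f /\ forall al, f @` lev (a al) = lev (a al).
Proof.
split=> -[fA fL]; split=> // al; first by apply: fL; rewrite -a_enum; exists al.
by rewrite -a_enum => -[be _ <-].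
Qed.

Lemma Aut_level_mem f al x : Aut_A f -> lev (a al) x -> lev (a al) (f x).
Proof. by move=> /Aut_levelP[_ fL] xL; rewrite -fL; exists x. Qed.

Lemma Aut_level_group : is_group Aut_A (@comp G G G).
Proof.
split.
- move=> f f' /Aut_levelP[[fB fM] fL] /Aut_levelP[[fB' fM'] fL'].
  apply/Aut_levelP; split; first by split=> [|x y /=]; [exact: bij_comp|rewrite fM' fM].
  by move=> al; rewrite -image_comp fL' fL.
- by [].
- exists id; first by apply/Aut_levelP; split=> [|al]; [split=> //; exists id|rewrite image_id].
  move=> f /Aut_levelP[[[f' fK f'K] fM] fL]; split=> //.
  exists f'; split; try by apply/funext => x /=; rewrite ?fK ?f'K.
  apply/Aut_levelP; split.
    split; first by exists f.
    by move=> x y; rewrite -[x in LHS]f'K -[y in LHS]f'K -fM fK.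
  move=> al; rewrite -{1}(fL al) image_comp.
  by rewrite (_ : f' \o f = id) ?image_id //; apply/funext => x /=; rewrite fK.
Qed.

(** The index set [P] is either all of [K], for gluing [Theta], or the part below a limit, for
    gluing [Psi]. *)
Definition coherent (P : set K) (F : K -> G -> G) : Prop :=
  (forall al, P al -> Aut_A (F al)) /\
  (forall al be x, P al -> (be < al)%O -> lev (a be) x -> F al x = F be x).

Lemma coherent_union P F al x : coherent P F -> P al -> lev (a al) x ->
  union_fun P L F x = F al x.
Proof.
move=> [_ FC]; apply: union_funE => i j y Pi Pj yi yj.
case: (ltgtP i j) => [ij|ji|->//]; last exact: FC ji yj.
by apply/esym; exact: FC ij yi.
Qed.

(** The levels form a chain, so any two elements of [H] lie in one level, where the glued map agrees
    with a single automorphism. *)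
Lemma coherent_aut_on P F H : coherent P F -> H = \bigcup_(al in P) lev (a al) ->
  aut_on H (union_fun P L F).
Proof.
move=> FC HE; have FA al : P al -> Aut_A (F al) by exact: FC.1.
have common x y : H x -> H y -> exists al, [/\ P al, lev (a al) x & lev (a al) y].
  rewrite HE => -[al Pal xal] [be Pbe xbe]; case: (leP al be) => h.
    by exists be; split=> //; exact: a_le xal.
  by exists al; split=> //; exact: (a_le (ltW h)).
split; last first.
  move=> x y Hx Hy; have [al [Pal xal yal]] := common x y Hx Hy.
  rewrite !(@coherent_union _ _ al) //; last exact: subgroupM.
  by have /Aut_levelP[[_ ->]] := FA _ Pal.
split.
- move=> x Hx; have [al [Pal xal _]] := common x x Hx Hx.
  rewrite (coherent_union FC Pal xal) HE; exists al => //.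
  exact: Aut_level_mem (FA _ Pal) xal.
- move=> x y /set_mem Hx /set_mem Hy; have [al [Pal xal yal]] := common x y Hx Hy.
  rewrite !(@coherent_union _ _ al) //.
  by have /Aut_levelP[[/bij_inj FI _] _] := FA _ Pal => /FI.
- move=> y Hy; have [al [Pal yal _]] := common y y Hy Hy.
  have /Aut_levelP[_ FL] := FA _ Pal.
  move: (yal); rewrite -(FL al) => -[x xal <-]; exists x; last exact: coherent_union FC Pal xal.
  by rewrite HE; exists al.
Qed.

(** * The automorphisms [Phi] and their coherence *)

Lemma Phi_nonlimit g al (nl : ~ is_limit al) : Phi g al =
  iota_inner (g (exist _ al nl)) \o (if opred al is Some be then Phi g be else id).
Proof.
by rewrite PhiE /Phi_step; case: pselect => // nl'; rewrite (Prop_irrelevance nl' nl).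
Qed.

Lemma Phi_limit g ga : is_limit ga ->
  Phi g ga = iota_inner (perm_elt rep (a ga) (Psi_of lev a (Phi g) ga)).
Proof. by move=> lim; rewrite PhiE /Phi_step; case: pselect. Qed.

Lemma Psi_aut_on F ga : is_limit ga -> coherent (below ga) F ->
  aut_on (lev (a ga)) (Psi_of lev a F ga).
Proof.
by move=> lim FC; apply: (coherent_aut_on FC); exact: (lev_a_limit wf G_limit A_club a_incr a_enum).
Qed.

Let iota_Psi F ga x : is_limit ga -> coherent (below ga) F -> lev (a ga) x ->
  iota_inner (perm_elt rep (a ga) (Psi_of lev a F ga)) x = Psi_of lev a F ga x.
Proof.
move=> lim FC; apply: (iota_perm_elt wf G_limit A_club); exact: Psi_aut_on.
Qed.

(** The element lies in the successor of level [a al], and that successor is at most [a be]. *)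
Lemma perm_elt_lev f al be : set_bij (lev (a al)) (lev (a al)) f -> (al < be)%O ->
  lev (a be) (perm_elt rep (a al) f).
Proof.
move=> fB albe; have [c ac] := ex_succ wf A_club (a al).
exact: (lev_succ_a G_limit a_incr ac albe) (perm_eltP G_limit ac fB).1.
Qed.

(** Level preservation and agreement are proved in one induction, because at a limit [Psi] is an
    automorphism only by coherence of all earlier stages. *)
Lemma Phi_coherent g : GA lev a g -> coherent setT (Phi g).
Proof.
move=> gGA.
suff H al : Aut_A (Phi g al) /\
    forall be x, (be < al)%O -> lev (a be) x -> Phi g al x = Phi g be x.
  by split=> [al _|al be x _]; have [h1 h2] := H al => //; exact: h2.
elim/(well_founded_ind wf): al => al IH.
have FC be : (be <= al)%O -> coherent (below be) (Phi g).
  by move=> beal; split=> [de /= h|de e x /= h]; have [h1 h2] := IH de (lt_le_trans h beal) => //; exact: h2.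
have [lim|nl] := pselect (is_limit al).
  have PC := FC al (lexx _); have [PB PM] := Psi_aut_on lim PC.
  rewrite Phi_limit //; set c := perm_elt _ _ _.
  have cE be x : (be < al)%O -> lev (a be) x -> iota_inner c x = Phi g be x.
    move=> beal xbe; rewrite /c iota_Psi //; last exact: (a_le (ltW beal)).
    exact: (coherent_union PC beal xbe).
  split=> //; apply/Aut_levelP; split=> [|be]; first exact: iota_inner_Aut.
  (* Below [al] the map agrees with [Phi g be]; above it [c] belongs to the level; at [al] itself it
     acts as [Psi]. *)
  case: (ltgtP be al) => [beal|albe|->].
  - have /Aut_levelP[_ bL] := (IH _ beal).1; rewrite -[RHS]bL.
    by apply: eq_imagel => x xbe; exact: cE.
  - by apply: iota_inner_image => //; exact: perm_elt_lev.
  - have [PL _ PS] := PB; apply/seteqP; split=> [_ [x xal <-]|y /PS[x xal <-]].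
      by rewrite /c iota_Psi //; exact: PL.
    by exists x => //; rewrite /c iota_Psi.
rewrite (Phi_nonlimit g nl); have [cL cC] := gGA (exist _ al nl).
move: cL cC; set c := g _; rewrite /lev_pred /= => cL cC.
have cLbe be : (al <= be)%O -> lev (a be) c by move=> /a_le; exact.
have [[opE al0]|[pal pal_succ opE]] := nonlimit_cases nl; rewrite opE in cC *.
  split=> [|be x]; last by rewrite ltNge al0.
  apply/Aut_levelP; split=> [|be]; first exact: iota_inner_Aut.
  by apply: iota_inner_image => //; exact: cLbe.
have [PA PC] := IH _ pal_succ.1; have [[PB PM] PL] := (Aut_levelP _).1 PA.
(* The factor [c] centralizes the level of the predecessor, so composing with its conjugation
   changes nothing on levels up to [pal]. *)
have cfix be x : (be <= pal)%O -> lev (a be) x -> iota_inner c x = x.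
  by move=> h /(a_le h) xL; apply/iota_inner_fix; exact: cC.
have [iB iM] := iota_inner_Aut c.
split.
  apply/Aut_levelP; split; first by split=> [|x y /=]; [exact: bij_comp|rewrite PM iM].
  move=> be; rewrite -image_comp PL; case: (ltP be al) => [/(is_succ_le pal_succ) h|h].
    by rewrite -[RHS]image_id; apply: eq_imagel => x; exact: cfix.
  by apply: iota_inner_image => //; exact: cLbe.
move=> be x /(is_succ_le pal_succ) h xbe /=.
rewrite (cfix be) //; last exact: Aut_level_mem.
by move: h; rewrite le_eqVlt => /orP[/eqP->//|h]; exact: PC.
Qed.

Lemma Phi_Aut g al : GA lev a g -> Aut_A (Phi g al).
Proof. by move=> /Phi_coherent[h _]; exact: h. Qed.

Lemma Theta_Phi g al x : GA lev a g -> lev (a al) x -> Theta g x = Phi g al x.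
Proof. by move=> /Phi_coherent gC; exact: (coherent_union gC). Qed.

Lemma Phi_coherent_below g ga : GA lev a g -> coherent (below ga) (Phi g).
Proof.
by move=> /Phi_coherent[h1 h2]; split=> [al _|al be x _]; [exact: h1|exact: h2].
Qed.

Lemma Psi_Phi g ga al x : GA lev a g -> (al < ga)%O -> lev (a al) x ->
  Psi_of lev a (Phi g) ga x = Phi g al x.
Proof. by move=> gGA; exact: (coherent_union (Phi_coherent_below ga gGA)). Qed.

Lemma Theta_Aut g : GA lev a g -> Aut_A (Theta g).
Proof.
move=> gGA; have gC := Phi_coherent gGA.
have [TB TM] : aut_on setT (Theta g).
  apply: (coherent_aut_on gC); apply/esym/seteqP; split=> // x _.
  by have [al xal] := lev_a_cover G_limit A_club a_enum x; exists al.
apply/Aut_levelP; split.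
  by split=> [|x y]; [rewrite -setTT_bijective|exact: TM].
move=> al; have /Aut_levelP[_ PL] := Phi_Aut al gGA; rewrite -[RHS]PL.
by apply: eq_imagel => x; exact: Theta_Phi.
Qed.

(** As [Phi g pal] maps the level of [pal] onto itself, the image of an element centralizing that
    level centralizes it too. *)
Lemma GA_mul_GA g h : GA lev a g -> GA lev a h -> GA lev a (GA_mul wf lev rep a g h).
Proof.
move=> gGA hGA [al nl]; have [gL gC] := gGA (exist _ al nl); have [hL hC] := hGA (exist _ al nl).
rewrite /GA_mul; move: gL gC hL hC; set u := g _; set v := h _; rewrite /lev_pred /=.
case opE: (opred al) => [pal|] gL gC hL hC; last first.
  by split=> [|_ ->]; [exact: subgroupM|exact: commute1].
have PA := Phi_Aut pal gGA; have /Aut_levelP[PAut PL] := PA.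
split; first by apply: subgroupM => //; exact: Aut_level_mem.
move=> y yL; apply/iota_inner_fix; rewrite iota_innerM /=.
move: (yL); rewrite -(PL pal) => -[x xL <-].
have vx : iota_inner v x = x by apply/iota_inner_fix; exact: hC.
rewrite -Aut_iota // vx; apply/iota_inner_fix; apply: gC.
exact: Aut_level_mem.
Qed.

(** At successors the twist in the product is exactly what moving [Phi g pal] past conjugation by
    the entry of [h] produces. At limits, [Psi] is multiplicative by induction and [perm_elt] turns
    composition into product. *)
Lemma Phi_mul g h al : GA lev a g -> GA lev a h ->
  Phi (GA_mul wf lev rep a g h) al = Phi g al \o Phi h al.
Proof.
move=> gGA hGA; have ghGA := GA_mul_GA gGA hGA.
elim/(well_founded_ind wf): al => al IH.
have [lim|nl] := pselect (is_limit al).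
  rewrite !Phi_limit // -iota_innerM.
  have [gB _] := Psi_aut_on lim (Phi_coherent_below al gGA).
  have [hB _] := Psi_aut_on lim (Phi_coherent_below al hGA).
  rewrite -(perm_eltM wf G_limit A_club gB hB); congr iota_inner.
  apply: (perm_elt_ext wf G_limit A_club); first exact: set_bij_comp hB gB.
  move=> x; rewrite (lev_a_limit wf G_limit A_club a_incr a_enum lim) => -[be beal xbe].
  rewrite /= (Psi_Phi ghGA beal xbe) (Psi_Phi hGA beal xbe) IH //=.
  by rewrite (Psi_Phi gGA beal) //; apply: Aut_level_mem => //; exact: Phi_Aut.
rewrite !(Phi_nonlimit _ nl) /GA_mul /=.
case opE: (opred al) => [pal|]; last by rewrite iota_innerM.
have palal := (opredP opE).1.
rewrite IH // iota_innerM; apply/funext => x /=; congr iota_inner.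
by rewrite -Aut_iota //; have /Aut_levelP[] := Phi_Aut pal gGA.
Qed.

Lemma Theta_mul g h : GA lev a g -> GA lev a h ->
  Theta (GA_mul wf lev rep a g h) = Theta g \o Theta h.
Proof.
move=> gGA hGA; apply/funext => x; have [al xal] := lev_a_cover G_limit A_club a_enum x.
have hxL := Aut_level_mem (Theta_Aut hGA) xal.
rewrite /= (Theta_Phi (GA_mul_GA gGA hGA) xal) (Theta_Phi gGA hxL).
by rewrite (Theta_Phi hGA xal) Phi_mul.
Qed.

(** The entries are recovered by induction: once the earlier stages agree, the two conjugations at a
    non-limit [al] coincide on level [a al], whose centre is trivial. *)
Lemma Theta_inj g h : GA lev a g -> GA lev a h -> Theta g = Theta h -> g = h.
Proof.
move=> gGA hGA gh.
suff Phi_eq al : Phi g al = Phi h al /\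
    forall nl : ~ is_limit al, g (exist _ al nl) = h (exist _ al nl).
  by apply/funext => -[al nl]; exact: (Phi_eq al).2.
elim/(well_founded_ind wf): al => al IH.
have [lim|nl] := pselect (is_limit al).
  split=> // ; rewrite !Phi_limit //; congr (iota_inner (perm_elt _ _ _)).
  apply/funext => x; rewrite /Psi_of /union_fun; congr xget; apply/seteqP.
  by split=> y [be [/= beal xbe ->]]; exists be; split=> //; rewrite (IH _ beal).1.
set F := if opred al is Some be then Phi g be else id.
have FA : Aut_A F.
  rewrite /F; case: opred => [be|]; first exact: Phi_Aut.
  by apply/Aut_levelP; split=> [|be]; [split=> //; exists id|rewrite image_id].
have gP : Phi g al = iota_inner (g (exist _ al nl)) \o F by exact: Phi_nonlimit.
have hP : Phi h al = iota_inner (h (exist _ al nl)) \o F.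
  rewrite (Phi_nonlimit _ nl) /F; case opE: (opred al) => [pal|//].
  by rewrite (IH _ (opredP opE).1).1.
suff e : g (exist _ al nl) = h (exist _ al nl).
  by split=> [|nl']; [rewrite gP hP e|rewrite (Prop_irrelevance nl' nl)].
have [[gL _] [hL _]] := (gGA (exist _ al nl), hGA (exist _ al nl)).
have [_ centre] := lev_a_complete wf n_ge7 G_limit a_nonlimit nl.
set u := g _ in gL gP *; set v := h _ in hL hP *.
suff /mulg1_eq : v^-1 * u = 1 by rewrite invgK.
apply: centre; first by apply: subgroupM => //; exact: subgroupV.
have /Aut_levelP[_ FL] := FA.
(* Every element of the level is some [F x], and both entries conjugate [F x] to the common value of
   [Theta] at [x]. *)
move=> y; rewrite -{1}(FL al) => -[x xal <-]; apply/iota_inner_fix.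
rewrite iota_innerM /=.
have : Phi g al x = Phi h al x by rewrite -!Theta_Phi // gh.
by rewrite gP hP /= => ->; rewrite iota_innerK.
Qed.

(** The quotients of consecutive conjugators telescope, so [Phi g al] is conjugation by [c al],
    which is [f] on level [a al]. *)
Lemma Theta_surj f : Aut_A f -> exists2 g, GA lev a g & Theta g = f.
Proof.
move=> fA; have /Aut_levelP[fAut fL] := fA.
have f_on al : aut_on (lev (a al)) f by exact: Aut_image_aut_on.
pose inner al := [set p | lev (a al) p /\ forall x, lev (a al) x -> f x = iota_inner p x].
(* At a limit, [c al] is [f] itself read as a permutation of the level, as in the definition of
   [Phi]; elsewhere completeness makes the choice succeed. *)
pose c al : G := if `[< is_limit al >] then perm_elt rep (a al) f else xget 1 (inner al).
have c_nonlimit al : ~ is_limit al ->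
    lev (a al) (c al) /\ forall x, lev (a al) x -> f x = iota_inner (c al) x.
  move=> nl; rewrite /c asboolF //.
  have [inn _] := lev_a_complete wf n_ge7 G_limit a_nonlimit nl.
  have [p pL pf] := inn f (f_on al).
  by apply: (@xgetPex _ 1 (inner al)); exists p.
have c_limit al : is_limit al -> c al = perm_elt rep (a al) f.
  by move=> lim; rewrite /c asboolT.
have cf al x : lev (a al) x -> iota_inner (c al) x = f x.
  have [lim|nl] := pselect (is_limit al) => xal; last by rewrite (c_nonlimit _ nl).2.
  by rewrite c_limit // (iota_perm_elt wf G_limit A_club).
have c_lt al be : (al < be)%O -> lev (a be) (c al).
  move=> albe; have [lim|nl] := pselect (is_limit al).
    by rewrite c_limit //; apply: perm_elt_lev => //; exact: (f_on al).1.
  exact: (a_le (ltW albe)) (c_nonlimit _ nl).1.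
pose c' al : G := if opred al is Some be then c be else 1.
pose g (al : nonlimit K) := c (sval al) * (c' (sval al))^-1.
have gGA : GA lev a g.
  move=> [al nl]; rewrite /g /c' /lev_pred /=; have [cL _] := c_nonlimit _ nl.
  case opE: (opred al) => [be|]; last first.
    by rewrite invg1 mulg1; split=> // _ ->; exact: commute1.
  have beal := (opredP opE).1; split.
    by apply: subgroupM => //; apply: subgroupV => //; exact: c_lt.
  (* Conjugation by [c be] and by [c al] both restrict to [f] on level [a be], so their quotient
     fixes that level pointwise. *)
  move=> y; rewrite -{1}(fL be) => -[x xbe <-]; apply/iota_inner_fix.
  rewrite iota_innerM /= -{1}(cf be) // iota_innerK cf //.
  exact: (a_le (ltW beal)).
have Phi_c al : Phi g al = iota_inner (c al).
  elim/(well_founded_ind wf): al => al IH; have [lim|nl] := pselect (is_limit al).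
    rewrite Phi_limit // c_limit //; congr iota_inner.
    apply: (perm_elt_ext wf G_limit A_club); first exact: (f_on al).1.
    move=> x; rewrite (lev_a_limit wf G_limit A_club a_incr a_enum lim) => -[be beal xbe].
    by rewrite (Psi_Phi gGA beal xbe) IH // cf.
  rewrite (Phi_nonlimit _ nl) /g /c' /=.
  case opE: (opred al) => [be|]; last by rewrite invg1 mulg1.
  by rewrite IH -?iota_innerM ?mulgVK //; exact: (opredP opE).1.
exists g => //; apply/funext => x.
have [al xal] := lev_a_cover G_limit A_club a_enum x.
by rewrite (Theta_Phi gGA xal) Phi_c cf.
Qed.

Lemma Theta_group_iso :
  group_iso (GA lev a) (GA_mul wf lev rep a) Aut_A (@comp G G G) Theta.
Proof.
have Theta_bij : set_bij (GA lev a) Aut_A Theta.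
  split; [exact: Theta_Aut| |by move=> f /Theta_surj[g gGA gf]; exists g].
  by move=> g h /set_mem gGA /set_mem hGA; exact: Theta_inj.
split; [|exact: Aut_level_group|exact: Theta_bij|exact: Theta_mul].
(* The group laws of [GA] are pulled back from the automorphism group along the injective
   multiplicative [Theta]; surjectivity supplies the identity and inverses. *)
have [_ compA [e eA e_inv]] := Aut_level_group.
split; first exact: GA_mul_GA.
- move=> x y z xGA yGA zGA; apply: Theta_inj; rewrite ?Theta_mul //;
    by do ?[exact: GA_mul_GA|apply: GA_mul_GA => //].
- have [e' e'GA e'E] := Theta_surj eA; exists e' => // g gGA.
  have [eg ge [f [fA fg gf]]] := e_inv _ (Theta_Aut gGA).
  have [f' f'GA f'E] := Theta_surj fA.
  split; try by apply: Theta_inj; rewrite ?Theta_mul ?e'E //; exact: GA_mul_GA.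
  exists f'; split=> //; apply: Theta_inj; rewrite ?Theta_mul ?e'E ?f'E //; exact: GA_mul_GA.
Qed.

End Theta.

Theorem theorem15 (d : Order.disp_t) (K : orderType d)
    (kappa_card : infinite_cardinal K)
    (n : nat) (n_ge7 : (7 <= n)%N)
    (G : groupType) (lev : K -> set G)
    (rep : forall alpha : K, G -> lev alpha -> lev alpha)
    (G_limit : regular_limit n lev rep)
    (card_G : [set: G] #= [set: K])
    (card_lev : forall alpha : K, card_lt (lev alpha) [set: K])
    (A : set K) (A_club : club A)
    (a : K -> K) (a_incr : forall alpha beta : K,
       (alpha < beta)%O -> (a alpha < a beta)%O)
    (a_enum : range a = A)
    (a_nonlimit : forall alpha : K, ~ is_limit alpha -> ~ is_limit (a alpha)) :
  group_iso (GA lev a) (GA_mul (cardinal_wf kappa_card) lev rep a)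
    (Aut_level lev A) (@comp G G G)
    (Theta (cardinal_wf kappa_card) lev rep a).
Proof.
exact: (Theta_group_iso _ n_ge7 G_limit A_club a_incr a_enum a_nonlimit).
Qed.
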